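(* Let $\alpha,\beta,\gamma$ be real parameters with $\gamma\neq0$ and $2\alpha^2\le\beta$. Then the potential $$G(x)=\frac{\left[2\alpha+\beta\gamma x-\alpha\sqrt{2\,(2+\beta\gamma^2x^2+4\alpha\gamma x)}\right]^2}{2\gamma^2(\beta-2\alpha^2)^2}$$ (read as its limit for $\beta\to2\alpha^2$ in the boundary case $\beta=2\alpha^2$) is isochronous, i.e. the equation $\ddot x+G'(x)=0$ has an isochronous center at $0$.
   Context: The equation $\ddot x+g(x)=0$ with $g=G'$ is identified with the planar system $\dot x=y$, $\dot y=-g(x)$. The center at the origin is called isochronous (and $G$ is then called an isochronous potential) if all periodic orbits near $(0,0)$ have the same minimal period (here $2\pi$, since $G''(0)=1$). *)

(* Defs.v *)
From Stdlib Require Import Reals.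
From Coquelicot Require Import Coquelicot.
Open Scope R_scope.

(* Solutions of  x' = y, y' = - g x  defined for all times, as curves
   t |-> (x t, y t). *)
Definition solution (g : R -> R) (z : R -> R * R) : Prop :=
  forall t : R,
    is_derive (fun s => fst (z s)) t (snd (z t)) /\
    is_derive (fun s => snd (z s)) t (- g (fst (z t))).

Definition is_period (T : R) (z : R -> R * R) : Prop :=
  0 < T /\ forall t : R, z (t + T) = z t.

(* Constant curves have no minimal period, so having one amounts to being a
   nontrivial periodic orbit (for continuous curves). *)
Definition minimal_period (T : R) (z : R -> R * R) : Prop :=
  is_period T z /\ forall S : R, is_period S z -> T <= S.

(* The origin is an equilibrium with a punctured neighbourhood filled with
   nontrivial periodic orbits. *)
Definition center (g : R -> R) : Prop :=
  g 0 = 0 /\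
  locally ((0, 0) : R * R) (fun p => p <> (0, 0) ->
    exists z : R -> R * R,
      solution g z /\ z 0 = p /\ exists T : R, minimal_period T z).

Definition isochronous_center (T : R) (g : R -> R) : Prop :=
  center g /\
  locally ((0, 0) : R * R) (fun p => p <> (0, 0) ->
    forall (z : R -> R * R) (S : R),
      solution g z -> z 0 = p -> minimal_period S z -> S = T).

(* The common period is fixed to 2 PI, the convention for potentials with
   G''(0) = 1.  Differentiability near 0 is required because [Derive] is a
   total operator. *)
Definition isochronous_potential (G : R -> R) : Prop :=
  locally 0 (fun x => ex_derive G x) /\
  isochronous_center (2 * PI) (Derive G).

Definition potential_formula (alpha beta gamma x : R) : R :=
  (2 * alpha + beta * gamma * x
   - alpha * sqrt (2 * (2 + beta * gamma ^ 2 * x ^ 2 + 4 * alpha * gamma * x))) ^ 2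
  / (2 * gamma ^ 2 * (beta - 2 * alpha ^ 2) ^ 2).

(* On the boundary beta = 2 alpha^2 the formula is 0/0 for x near 0; there the
   value is the pointwise limit in beta, with alpha, gamma and x fixed.  This
   limit is finite for 1 + alpha gamma x > 0, in particular for x near 0. *)
Definition potential (alpha beta gamma x : R) : R :=
  if Req_EM_T beta (2 * alpha ^ 2)
  then real (Lim (fun b => potential_formula alpha b gamma x) (2 * alpha ^ 2))
  else potential_formula alpha beta gamma x.

(* Main.v *)
Require Import Defs.
From Stdlib Require Import Reals Lra Classical IndefiniteDescription Ranalysis5.
From Coquelicot Require Import Coquelicot.
Open Scope R_scope.

(* Put c = alpha gamma, k = beta gamma^2 / 2 and q = sqrt (1 + k u^2).  The
   substitution x = X u := u + c u^2 / (1 + q) turns the potential into the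
   harmonic one, G (X u) = u^2 / 2, and X u - u is even in u.  The condition
   2 alpha^2 <= beta is c^2 <= k, whence X' u = 1 + c u / q > 0.

   For any such X, in the plane (u, y) an orbit is a circle of radius r run
   clockwise with angular speed 1 / X' u.  The time as a function of the angle
   thus has derivative X' (r cos th); since X' u + X' (-u) = 2, two opposite
   half turns together take 2 PI for every r.  Each solution starting near
   the origin has this form: energy conservation keeps it in the chart, and
   its angle is recovered by integrating 1 / X' u along the solution. *)

(** * Calculus on the line: inverse functions, polar angles, real induction *)

Lemma locally_between (P : R -> Prop) (a b t : R) :
  a < t < b -> (forall s, a < s < b -> P s) -> locally t P.
Proof.
intros Ht HP.
assert (Hd : 0 < Rmin (t - a) (b - t)) by (apply Rmin_pos; lra).
exists (mkposreal _ Hd); intros s Hs.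
apply Rabs_lt_between in Hs; simpl in Hs; unfold minus, plus, opp in Hs; simpl in Hs.
pose proof (Rmin_l (t - a) (b - t)); pose proof (Rmin_r (t - a) (b - t)).
apply HP; lra.
Qed.

Lemma is_derive_continuity_pt (f : R -> R) (x l : R) :
  is_derive f x l -> continuity_pt f x.
Proof.
intros H; apply continuity_pt_filterlim, (ex_derive_continuous f).
now exists l.
Qed.

(** Extended endpoints cover both uses: a chart on a bounded interval and an angle on the whole
    line. The inverse is a total function picked by choice and arbitrary off the image, so the last
    clause records that the image is open. *)
Lemma increasing_inverse (f df : R -> R) (a b : Rbar) :
  (forall x : R, Rbar_lt a x -> Rbar_lt x b -> is_derive f x (df x)) ->
  (forall x : R, Rbar_lt a x -> Rbar_lt x b -> 0 < df x) ->
  exists g : R -> R, forall x : R, Rbar_lt a x -> Rbar_lt x b ->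
    g (f x) = x /\ is_derive g (f x) (/ df x) /\
    locally (f x) (fun s => Rbar_lt a (g s) /\ Rbar_lt (g s) b /\ f (g s) = s).
Proof.
intros Hf Hpos.
assert (Hinc := incr_function f a b df Hf Hpos).
destruct (functional_choice (fun y x : R =>
  (exists x' : R, Rbar_lt a x' /\ Rbar_lt x' b /\ f x' = y) ->
  Rbar_lt a x /\ Rbar_lt x b /\ f x = y)) as [g Hg].
{ intros y; destruct (classic
    (exists x' : R, Rbar_lt a x' /\ Rbar_lt x' b /\ f x' = y)) as [[x Hx]|H].
  - now exists x.
  - now exists 0. }
assert (Hgf : forall x : R, Rbar_lt a x -> Rbar_lt x b -> g (f x) = x).
{ intros x Ha Hb; destruct (Hg (f x)) as [H1 [H2 H3]]; [now exists x|].
  destruct (Rtotal_order (g (f x)) x) as [H|[H|H]]; [|assumption|].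
  - specialize (Hinc _ _ H1 H Hb); lra.
  - specialize (Hinc _ _ Ha H H2); lra. }
exists g; intros x Ha Hb; split; [now apply Hgf|].
assert (Hloc : locally x (fun z : R => Rbar_lt a z /\ Rbar_lt z b)).
{ apply filter_and; [now apply open_Rbar_gt|now apply open_Rbar_lt]. }
destruct Hloc as [e He].
assert (Hin : forall z, x - e < z < x + e -> Rbar_lt a z /\ Rbar_lt z b).
{ intros z Hz; apply He; apply Rabs_lt_between; unfold minus, plus, opp; simpl; lra. }
assert (He0 := cond_pos e).
(* By the intermediate value theorem, every value between [f (x - d)] and [f (x + d)] is attained in
   between, and [g] returns that point. *)
assert (Hnear : forall d, 0 < d < e ->
  forall s, f (x - d) <= s <= f (x + d) ->
  x - d <= g s <= x + d /\ Rbar_lt a (g s) /\ Rbar_lt (g s) b /\ f (g s) = s).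
{ intros d Hd s Hs.
  destruct (f_interv_is_interv f (x - d) (x + d) s) as [z [Hz Hfz]];
    [lra|assumption| |].
  - intros c Hc; destruct (Hin c) as [H1 H2]; [lra|].
    now apply is_derive_continuity_pt with (df c), Hf.
  - destruct (Hin z) as [H1 H2]; [lra|].
    rewrite <- Hfz, Hgf by assumption; tauto. }
assert (Himg : forall d, 0 < d < e -> f (x - d) < f x < f (x + d)).
{ intros d Hd; split; apply Hinc; try lra; apply Hin; lra. }
assert (Hinv : locally (f x)
  (fun s => Rbar_lt a (g s) /\ Rbar_lt (g s) b /\ f (g s) = s)).
{ apply locally_between with (f (x - e / 2)) (f (x + e / 2)).
  - apply Himg; lra.
  - intros s Hs; apply (Hnear (e / 2)); lra. }
split; [|assumption].
assert (Hcont : continuity_pt g (f x)).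
{ apply continuity_pt_filterlim, filterlim_locally; intros eps.
  set (d := Rmin (e / 2) (eps / 2)).
  assert (Heps := cond_pos eps).
  assert (Hd : 0 < d < e /\ d < eps).
  { unfold d; pose proof (Rmin_l (e / 2) (eps / 2));
      pose proof (Rmin_r (e / 2) (eps / 2));
      pose proof (Rmin_pos (e / 2) (eps / 2)); lra. }
  apply locally_between with (f (x - d)) (f (x + d)); [now apply Himg|].
  intros s Hs; destruct (Hnear d (proj1 Hd) s) as [H _]; [lra|].
  rewrite Hgf by assumption.
  apply Rabs_lt_between; unfold minus, plus, opp; simpl; lra. }
assert (Hd : 0 < e / 2 < e) by lra.
assert (Hi := Himg _ Hd).
destruct (Hin (x - e / 2)) as [L1 L2]; [lra|].
destruct (Hin (x + e / 2)) as [R1 R2]; [lra|].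
assert (Prf : forall c : R, g (f (x - e / 2)) <= c <= g (f (x + e / 2)) -> derivable_pt f c).
{ rewrite !Hgf by assumption; intros c Hc; exists (df c).
  apply is_derive_Reals, Hf; apply Hin; lra. }
assert (Hg3 : g (f (x - e / 2)) <= g (f x) <= g (f (x + e / 2))).
{ rewrite !Hgf by assumption; lra. }
assert (Hval : derive_pt f (g (f x)) (Prf _ Hg3) = df x).
{ apply derive_pt_eq; rewrite Hgf by assumption; now apply is_derive_Reals, Hf. }
apply is_derive_Reals.
replace (/ df x) with (1 / derive_pt f (g (f x)) (Prf _ Hg3)).
2:{ rewrite Hval; unfold Rdiv; ring. }
apply derivable_pt_lim_recip_interv with (f (x - e / 2)) (f (x + e / 2)); try assumption.
- lra.
- intros s Hs; unfold comp, id; apply (Hnear (e / 2)); lra.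
- rewrite Hval; apply Rgt_not_eq, Hpos; assumption.
Qed.

Lemma is_derive_0_const (f : R -> R) :
  (forall t, is_derive f t 0) -> forall a b, f a = f b.
Proof.
intros H a b.
destruct (Rtotal_order a b) as [h|[h|h]]; [|now rewrite h|symmetry];
  apply (eq_is_derive f); auto.
Qed.

Lemma cos_eq_1_lt_2PI (d : R) : 0 < d < 2 * PI -> cos d <> 1.
Proof.
intros Hd H.
assert (Hs : 0 < sin (d / 2)) by (apply sin_gt_0; lra).
assert (Hc := cos_2a_sin (d / 2)).
replace (2 * (d / 2)) with d in Hc by field; nra.
Qed.

Lemma polar_clockwise (u y : R) :
  exists th, u = sqrt (u ^ 2 + y ^ 2) * cos th /\ y = - sqrt (u ^ 2 + y ^ 2) * sin th.
Proof.
set (r := sqrt (u ^ 2 + y ^ 2)).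
assert (Hr2 : r * r = u ^ 2 + y ^ 2) by (apply sqrt_sqrt; nra).
assert (Hr0 : 0 <= r) by apply sqrt_pos.
destruct (Req_dec r 0) as [H0|H0].
{ exists 0; rewrite H0 in *; split; nra. }
assert (Hrp : 0 < r) by lra.
assert (Hu : -1 <= u / r <= 1).
{ assert (-r <= u <= r) by nra.
  split; [apply Rmult_le_reg_r with r|apply Rmult_le_reg_r with r]; try assumption;
  unfold Rdiv; rewrite Rmult_assoc, Rinv_l; lra. }
assert (Hcos := cos_acos _ Hu).
assert (Hsin := sin_acos _ Hu).
assert (Hs : r * sin (acos (u / r)) = Rabs y).
{ rewrite Hsin, <- (sqrt_Rsqr_abs y), <- (sqrt_Rsqr r) by assumption.
  rewrite <- sqrt_mult_alt by (unfold Rsqr; nra).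
  f_equal; unfold Rsqr; rewrite sqrt_square by lra.
  field_simplify; [lra|assumption]. }
(* [acos] only reaches angles in [0, PI]; the sign of [y] selects the half plane. *)
destruct (Rle_dec 0 y) as [Hy|Hy].
- exists (- acos (u / r)); rewrite cos_neg, sin_neg, Hcos.
  rewrite Rabs_right in Hs by lra; split; [field; assumption|lra].
- exists (acos (u / r)); rewrite Hcos.
  rewrite Rabs_left in Hs by lra; split; [field; assumption|lra].
Qed.

(** Real induction: at the supremum of the times up to which [P] has held throughout, the closure
    hypothesis gives [P] and the openness hypothesis carries it further. *)
Lemma forward_induction (P : R -> Prop) :
  P 0 ->
  (forall t, 0 <= t -> P t -> locally t P) ->
  (forall t, 0 < t -> (forall s, 0 <= s < t -> P s) -> P t) ->
  forall t, 0 <= t -> P t.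
Proof.
intros P0 Pop Pstep t1 Ht1.
set (E := fun t => 0 <= t <= t1 /\ forall s, 0 <= s <= t -> P s).
destruct (completeness E) as [m [Hub Hlub]].
{ exists t1; intros t [Ht _]; lra. }
{ exists 0; split; [lra|]; intros s Hs; now replace s with 0 by lra. }
assert (H0 : 0 <= m).
{ apply Hub; split; [lra|]; intros s Hs; now replace s with 0 by lra. }
assert (Hm1 : m <= t1) by (apply Hlub; intros t [Ht _]; lra).
assert (Hlt : forall s, 0 <= s < m -> P s).
{ intros s Hs; destruct (classic (P s)) as [h|h]; [assumption|].
  assert (m <= s); [|lra].
  apply Hlub; intros t [Ht Hall]; destruct (Rle_dec t s) as [|Hn]; [assumption|].
  elim h; apply Hall; lra. }
assert (Pm : P m).
{ destruct (Req_dec m 0) as [->|]; [assumption|]; apply Pstep; [lra|assumption]. }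
destruct (Pop m H0 Pm) as [e He]; assert (He0 := cond_pos e).
(* The cap at [t1] keeps the new time in [E]: it either lies beyond the supremum [m] or is [t1]
   itself. *)
assert (Hm : E (Rmin (m + e / 2) t1)).
{ pose proof (Rmin_l (m + e / 2) t1); pose proof (Rmin_r (m + e / 2) t1).
  split; [split; [apply Rmin_glb|]; lra|].
  intros s Hs; destruct (Rlt_dec s m); [apply Hlt; lra|].
  apply He, Rabs_lt_between; unfold minus, plus, opp; simpl; lra. }
destruct (Rle_dec (m + e / 2) t1) as [h|h].
- rewrite Rmin_left in Hm by assumption; specialize (Hub _ Hm); lra.
- rewrite Rmin_right in Hm by lra; apply Hm; lra.
Qed.

(** * Charts that make the potential harmonic *)

(* [chart_even] is the derivative of X u - X (- u) = 2 u. *)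
Record even_shear_chart (G X dX : R -> R) (rho : R) : Prop := {
  chart_0 : X 0 = 0;
  chart_derive : forall u, -rho < u < rho -> is_derive X u (dX u);
  chart_continuous : forall u, -rho < u < rho -> continuous dX u;
  chart_pos : forall u, -rho < u < rho -> 0 < dX u;
  chart_even : forall u, -rho < u < rho -> dX u + dX (- u) = 2;
  chart_potential : forall u, -rho < u < rho -> G (X u) = u ^ 2 / 2 }.

(** [U] is total and unconstrained off the image of [X]; the second condition is what places [x] in
    that image. *)
Definition in_chart (X U : R -> R) (rho x : R) : Prop :=
  -rho < U x < rho /\ X (U x) = x.

Definition chart_inverse (X dX U : R -> R) (rho : R) : Prop :=
  forall u, -rho < u < rho ->
    U (X u) = u /\ is_derive U (X u) (/ dX u) /\
    locally (X u) (in_chart X U rho).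

Lemma chart_inverse_exists (G X dX : R -> R) (rho : R) :
  even_shear_chart G X dX rho -> exists U, chart_inverse X dX U rho.
Proof.
intros [H0 HX _ Hpos _ _].
destruct (increasing_inverse X dX (-rho) rho) as [U HU].
- intros u h1 h2; now apply HX.
- intros u h1 h2; now apply Hpos.
- exists U; intros u Hu; destruct (HU u) as [h1 [h2 h3]]; simpl; [tauto|tauto|].
  split; [assumption|split; [assumption|]].
  revert h3; apply filter_imp; unfold in_chart; simpl; tauto.
Qed.

Lemma in_chart_image (X dX U : R -> R) (rho u : R) :
  chart_inverse X dX U rho -> -rho < u < rho -> in_chart X U rho (X u).
Proof.
intros HU Hu; destruct (HU u Hu) as [h _]; unfold in_chart; rewrite h; tauto.
Qed.

(** Near [X u] the potential agrees with half the square of [U], whose derivative is U U'. *)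
Lemma chart_is_derive_potential (G X dX : R -> R) (rho u : R) :
  even_shear_chart G X dX rho -> -rho < u < rho ->
  is_derive G (X u) (u / dX u).
Proof.
intros HX Hu; destruct (chart_inverse_exists _ _ _ _ HX) as [U HU].
destruct (HU u Hu) as [hu [hd hl]].
apply is_derive_ext_loc with (fun x => U x ^ 2 / 2).
{ revert hl; apply filter_imp; intros x [h1 h2].
  rewrite <- h2 at 2; symmetry; now apply (chart_potential _ _ _ _ HX). }
auto_derive; [now exists (/ dX u)|].
replace (Derive _ (X u)) with (/ dX u) by (symmetry; now apply is_derive_unique).
rewrite hu; simpl; field; apply Rgt_not_eq, (chart_pos _ _ _ _ HX _ Hu).
Qed.

(** * Time as a function of the angle on a circle *)

Lemma cos_scaled_bound (r rho th : R) :
  0 <= r < rho -> -rho < r * cos th < rho.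
Proof. intros Hr; pose proof (COS_bound th); nra. Qed.

(** [T] is the integral of [dX (r * cos p)]. A half turn changes the sign of the cosine, so by
    [chart_even] the sum [T (th + PI) + T th] grows at the constant rate 2. *)
Lemma phase_time_exists (G X dX : R -> R) (rho r : R) :
  even_shear_chart G X dX rho -> 0 <= r < rho ->
  exists T : R -> R,
    (forall th, is_derive T th (dX (r * cos th))) /\
    (forall th, T (th + 2 * PI) = T th + 2 * PI).
Proof.
intros HX Hr.
assert (Hc : forall th, continuous (fun p => dX (r * cos p)) th).
{ intros th; apply (continuous_comp (fun p => r * cos p) dX).
  - apply (ex_derive_continuous (fun p => r * cos p)); auto_derive; trivial.
  - apply (chart_continuous _ _ _ _ HX), cos_scaled_bound, Hr. }
exists (fun th => RInt (fun p => dX (r * cos p)) 0 th).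
set (T := fun th => RInt (fun p => dX (r * cos p)) 0 th).
assert (HT : forall th, is_derive T th (dX (r * cos th))).
{ intros th; apply (is_derive_RInt (fun p => dX (r * cos p)) T 0 th); [|apply Hc].
  apply filter_forall; intros b; apply (RInt_correct (V := R_CompleteNormedModule)).
  apply ex_RInt_continuous; intros; apply Hc. }
change ((forall th, is_derive T th (dX (r * cos th))) /\
  (forall th, T (th + 2 * PI) = T th + 2 * PI)).
split; [exact HT|].
clearbody T.
assert (Hhalf : forall th, is_derive (fun s => T (s + PI) + T s - 2 * s) th 0).
{ intros th; auto_derive.
  - split; [now exists (dX (r * cos (th + PI)))|].
    split; [now exists (dX (r * cos th))|trivial].
  - rewrite (is_derive_unique (fun x : R => T x) _ _ (HT th)), (is_derive_unique (fun x : R => T x) _ _ (HT (th + PI))).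
    rewrite neg_cos, <- Ropp_mult_distr_r.
    pose proof (chart_even _ _ _ _ HX _ (cos_scaled_bound r rho th Hr)); lra. }
intros th.
(* Comparing the constant at [th + PI] and at [th] cancels [T (th + PI)] and leaves the full
   turn. *)
pose proof (is_derive_0_const _ Hhalf (th + PI) th) as H; simpl in H.
replace (th + PI + PI) with (th + 2 * PI) in H by ring; lra.
Qed.

Lemma phase_time_increasing (G X dX T : R -> R) (rho r : R) :
  even_shear_chart G X dX rho -> 0 <= r < rho ->
  (forall th, is_derive T th (dX (r * cos th))) ->
  forall a b, a < b -> T a < T b.
Proof.
intros HX Hr HT a b Hab.
apply (incr_function T m_infty p_infty (fun th => dX (r * cos th)));
  try exact I; try assumption; intros th _ _.
- apply HT.
- apply (chart_pos _ _ _ _ HX), cos_scaled_bound, Hr.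
Qed.

(** Iterating the shift gives T(±np) = T(0) ± np, unbounded on both sides; continuity fills the
    gaps. *)
Lemma quasiperiodic_surjective (T : R -> R) (p : R) :
  0 < p -> continuity T -> (forall th, T (th + p) = T th + p) ->
  forall t, exists th, T th = t.
Proof.
intros Hp HT Hper t.
assert (Hn : forall n : nat, T (INR n * p) = T 0 + INR n * p /\
                             T (- (INR n * p)) = T 0 - INR n * p).
{ induction n as [|n [IH1 IH2]].
  - simpl; rewrite Rmult_0_l, Ropp_0; lra.
  - rewrite S_INR; split.
    + replace ((INR n + 1) * p) with (INR n * p + p) by ring; rewrite Hper; lra.
    + specialize (Hper (- ((INR n + 1) * p))).
      replace (- ((INR n + 1) * p) + p) with (- (INR n * p)) in Hper by ring; lra. }
destruct (INR_archimed p (Rabs (t - T 0)) Hp) as [n Hlarge].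
destruct (Hn n) as [h1 h2].
assert (Habs := Rabs_def2 _ _ Hlarge).
destruct (IVT_gen T (- (INR n * p)) (INR n * p) t HT) as [th [_ Hth]].
- pose proof (Rmin_l (T (- (INR n * p))) (T (INR n * p))).
  pose proof (Rmax_r (T (- (INR n * p))) (T (INR n * p))); lra.
- now exists th.
Qed.

(** * Global solutions running along the circles *)

(** Inverting the phase time yields the angle as a function of time, defined for all times because
    [T] is onto; the circle traversed with this angle is the solution. *)
Lemma chart_solution_exists (G X dX : R -> R) (rho r th0 : R) :
  even_shear_chart G X dX rho -> 0 <= r < rho ->
  exists z, solution (Derive G) z /\ z 0 = (X (r * cos th0), - r * sin th0).
Proof.
intros HX Hr.
destruct (phase_time_exists _ _ _ _ _ HX Hr) as [T [HT Hper]].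
destruct (increasing_inverse T (fun th => dX (r * cos th)) m_infty p_infty)
  as [F HF].
- intros th _ _; apply HT.
- intros th _ _; apply (chart_pos _ _ _ _ HX), cos_scaled_bound, Hr.
- assert (Hsurj : forall t, exists th, T th = t).
  { apply (quasiperiodic_surjective T (2 * PI)); [pose proof PI_RGT_0; lra| |assumption].
    intros th; apply (is_derive_continuity_pt _ _ _ (HT th)). }
  (* The shift by [T th0] makes the angle start at [th0]. *)
  set (phi := fun t => F (t + T th0)).
  assert (Hphi : forall t, is_derive phi t (/ dX (r * cos (phi t)))).
  { intros t; destruct (Hsurj (t + T th0)) as [th Hth].
    destruct (HF th I I) as [h1 [h2 _]].
    unfold phi; rewrite <- Hth, h1.
    replace (/ dX (r * cos th)) with (scal 1 (/ dX (r * cos th)))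
      by (unfold scal; simpl; unfold mult; simpl; ring).
    apply (is_derive_comp F (fun s => s + T th0)); [now rewrite <- Hth|].
    auto_derive; trivial; ring. }
  exists (fun t => (X (r * cos (phi t)), - r * sin (phi t))); split.
  + intros t; simpl.
    assert (Hb := cos_scaled_bound r rho (phi t) Hr).
    assert (Hp := chart_pos _ _ _ _ HX _ Hb).
    split.
    * replace (- r * sin (phi t))
        with (scal (/ dX (r * cos (phi t)) * (- r * sin (phi t))) (dX (r * cos (phi t))))
        by (unfold scal; simpl; unfold mult; simpl; field; lra).
      apply (is_derive_comp X (fun s => r * cos (phi s))).
      -- now apply (chart_derive _ _ _ _ HX).
      -- auto_derive; [now exists (/ dX (r * cos (phi t)))|].
         rewrite (is_derive_unique (fun x : R => phi x) _ _ (Hphi t)); ring.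
    * rewrite (is_derive_unique _ _ _ (chart_is_derive_potential _ _ _ _ _ HX Hb)).
      auto_derive; [now exists (/ dX (r * cos (phi t)))|].
      rewrite (is_derive_unique (fun x : R => phi x) _ _ (Hphi t)); field; lra.
  + unfold phi; rewrite Rplus_0_l; destruct (HF th0 I I) as [-> _]; reflexivity.
Qed.

(** * Energy conservation and confinement to the chart *)

(** In the coordinates (u, y) the system is a rotation whose speed 1 / X'(u) depends on the
    position. *)
Lemma chart_solution_derive (G X dX U : R -> R) (rho t : R) (z : R -> R * R) :
  even_shear_chart G X dX rho -> chart_inverse X dX U rho ->
  solution (Derive G) z -> in_chart X U rho (fst (z t)) ->
  is_derive (fun s => U (fst (z s))) t (snd (z t) / dX (U (fst (z t)))) /\
  is_derive (fun s => snd (z s)) t (- U (fst (z t)) / dX (U (fst (z t)))).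
Proof.
intros HX HU Hz [Hb Hu]; destruct (Hz t) as [h1 h2].
assert (HG := chart_is_derive_potential _ _ _ _ _ HX Hb).
destruct (HU _ Hb) as [_ [hd _]].
rewrite Hu in HG, hd; split.
- apply (is_derive_comp U (fun s => fst (z s)) t _ _ hd h1).
- rewrite (is_derive_unique _ _ _ HG) in h2.
  replace (- U (fst (z t)) / dX (U (fst (z t))))
    with (- (U (fst (z t)) / dX (U (fst (z t))))) by (unfold Rdiv; ring).
  exact h2.
Qed.

Lemma is_derive_sum_squares (u y : R -> R) (t du dy : R) :
  is_derive u t du -> is_derive y t dy ->
  is_derive (fun s => u s ^ 2 + y s ^ 2) t (2 * (u t * du + y t * dy)).
Proof.
intros Hu Hy; auto_derive.
- split; [now exists du|split; [now exists dy|trivial]].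
- rewrite (is_derive_unique (fun x : R => u x) _ _ Hu).
  rewrite (is_derive_unique (fun x : R => y x) _ _ Hy); ring.
Qed.

Lemma chart_energy_derive (G X dX U : R -> R) (rho t : R) (z : R -> R * R) :
  even_shear_chart G X dX rho -> chart_inverse X dX U rho ->
  solution (Derive G) z -> in_chart X U rho (fst (z t)) ->
  is_derive (fun s => U (fst (z s)) ^ 2 + snd (z s) ^ 2) t 0.
Proof.
intros HX HU Hz Hin.
destruct (chart_solution_derive _ _ _ _ _ _ _ HX HU Hz Hin) as [h1 h2].
eassert (H := is_derive_sum_squares _ _ _ _ _ h1 h2).
match type of H with is_derive _ _ ?l => replace 0 with l; [exact H|] end.
unfold Rdiv; ring.
Qed.

(** Energy confines u to [-r, r], a compact part of the open chart since [r < rho]. The bounds on x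
    are closed, so they survive at a limit time and the orbit cannot leave. *)
Lemma chart_orbit_forward (G X dX U : R -> R) (rho r : R) (z : R -> R * R) :
  even_shear_chart G X dX rho -> chart_inverse X dX U rho -> 0 <= r < rho ->
  solution (Derive G) z -> in_chart X U rho (fst (z 0)) ->
  U (fst (z 0)) ^ 2 + snd (z 0) ^ 2 = r ^ 2 ->
  forall t, 0 <= t -> in_chart X U rho (fst (z t)).
Proof.
intros HX HU Hr Hz H0 Hr0.
assert (Hcont : forall t, continuous (fun s => fst (z s)) t).
{ intros t; apply (ex_derive_continuous (fun s => fst (z s))).
  exists (snd (z t)); apply Hz. }
assert (Hinc : forall u v, -rho < u -> u < v -> v < rho -> X u < X v).
{ apply (incr_function X (-rho) rho dX); simpl; intros u h1 h2.
  - now apply (chart_derive _ _ _ _ HX).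
  - now apply (chart_pos _ _ _ _ HX). }
apply forward_induction; [assumption| |].
- intros t _ [Ht1 Ht2].
  apply (Hcont t (in_chart X U rho)); rewrite <- Ht2; now apply HU.
- intros t Ht Hs.
  assert (HE : forall s, 0 <= s < t -> X (- r) <= fst (z s) <= X r).
  { intros s Hst; destruct (Hs s Hst) as [h1 h2].
    assert (He : U (fst (z s)) ^ 2 + snd (z s) ^ 2 = r ^ 2).
    { rewrite <- Hr0; destruct (Req_dec s 0) as [->|Hs0]; [reflexivity|].
      symmetry; apply (eq_is_derive (fun s => U (fst (z s)) ^ 2 + snd (z s) ^ 2));
        [|lra].
      intros v Hv; apply (chart_energy_derive _ _ _ _ _ _ _ HX HU Hz), Hs; lra. }
    assert (Hu : - r <= U (fst (z s)) <= r) by nra.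
    rewrite <- h2; split.
    - destruct (proj1 Hu) as [h|h]; [|rewrite h; lra].
      left; apply Hinc; lra.
    - destruct (proj2 Hu) as [h|h]; [|rewrite h; lra].
      left; apply Hinc; lra. }
  (* Any open condition at time [t] already holds at some earlier time, where it can be confronted
     with [HE]. *)
  assert (Hlim : forall P : R -> Prop, locally (fst (z t)) P ->
    exists s, 0 <= s < t /\ P (fst (z s))).
  { intros P HP; destruct (Hcont t P HP) as [e He]; assert (He0 := cond_pos e).
    pose proof (Rmax_l 0 (t - e / 2)); pose proof (Rmax_r 0 (t - e / 2)).
    assert (Rmax 0 (t - e / 2) < t) by (apply Rmax_lub_lt; lra).
    exists (Rmax 0 (t - e / 2)); split; [lra|].
    apply He, Rabs_lt_between; unfold minus, plus, opp; simpl; lra. }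
  assert (Hb : X (- r) <= fst (z t) <= X r).
  { split; apply Rnot_lt_le; intros h.
    - destruct (Hlim (fun x => x < X (- r))) as [s [h1 h2]]; [now apply open_lt|].
      specialize (HE s h1); lra.
    - destruct (Hlim (fun x => X r < x)) as [s [h1 h2]]; [now apply open_gt|].
      specialize (HE s h1); lra. }
  (* For [r = 0] the interval from [-r] to [r] is a single point, and the intermediate value theorem
     below asks for a proper interval. *)
  destruct (Req_dec r 0) as [->|Hrp].
  { rewrite Ropp_0 in Hb; replace (fst (z t)) with (X 0) by lra.
    apply (in_chart_image _ _ _ _ _ HU); lra. }
  destruct (f_interv_is_interv X (- r) r (fst (z t))) as [u [hu <-]];
    [lra|assumption| |apply (in_chart_image _ _ _ _ _ HU); lra].
  intros u hu; apply (is_derive_continuity_pt X u (dX u)).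
  apply (chart_derive _ _ _ _ HX); lra.
Qed.

(** This symmetry carries the forward confinement over to negative times. *)
Lemma solution_time_reversal (g : R -> R) (z : R -> R * R) :
  solution g z -> solution g (fun t => (fst (z (- t)), - snd (z (- t)))).
Proof.
intros Hz t; destruct (Hz (- t)) as [h1 h2]; simpl.
assert (Hrev : forall (f : R -> R) (l : R), is_derive f (- t) l ->
  is_derive (fun s => f (- s)) t (- l)).
{ intros f l Hf; replace (- l) with (scal (-1) l)
    by (unfold scal; simpl; unfold mult; simpl; ring).
  apply (is_derive_comp f Ropp t l (-1)); [assumption|].
  auto_derive; trivial; ring. }
split.
- exact (Hrev _ _ h1).
- rewrite <- (Ropp_involutive (- g _)).
  apply (is_derive_opp (fun s => snd (z (- s)))), (Hrev _ _ h2).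
Qed.

Lemma chart_orbit (G X dX U : R -> R) (rho r : R) (z : R -> R * R) :
  even_shear_chart G X dX rho -> chart_inverse X dX U rho -> 0 <= r < rho ->
  solution (Derive G) z -> in_chart X U rho (fst (z 0)) ->
  U (fst (z 0)) ^ 2 + snd (z 0) ^ 2 = r ^ 2 ->
  forall t, in_chart X U rho (fst (z t)).
Proof.
intros HX HU Hr Hz H0 Hr0 t.
destruct (Rle_dec 0 t) as [Ht|Ht].
- now apply (chart_orbit_forward G X dX U rho r z).
- rewrite <- (Ropp_involutive t).
  apply (chart_orbit_forward G X dX U rho r
    (fun t => (fst (z (- t)), - snd (z (- t))))); simpl;
    try rewrite Ropp_0; try assumption; [now apply solution_time_reversal| |lra].
  simpl in Hr0; rewrite <- Hr0; ring.
Qed.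

(** * The angle along a solution and its minimal period *)

(** In the frame turning with the angle [phi], the point (u, y) has both coordinates constant, equal
    to r and 0. This takes the place of an appeal to uniqueness of solutions. *)
Lemma rotating_frame (u y b phi : R -> R) (r : R) :
  (forall t, is_derive u t (b t * y t)) ->
  (forall t, is_derive y t (- (b t * u t))) ->
  (forall t, is_derive phi t (b t)) ->
  u 0 = r * cos (phi 0) -> y 0 = - r * sin (phi 0) ->
  forall t, u t = r * cos (phi t) /\ y t = - r * sin (phi t).
Proof.
intros Hu Hy Hphi Hu0 Hy0 t.
assert (HA : forall s, is_derive (fun s => u s * cos (phi s) - y s * sin (phi s)) s 0).
{ intros s; auto_derive.
  - split; [now exists (b s * y s)|split; [now exists (b s)|]].
    split; [now exists (- (b s * u s))|split; [now exists (b s)|trivial]].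
  - rewrite (is_derive_unique (fun x : R => u x) _ _ (Hu s)).
    rewrite (is_derive_unique (fun x : R => y x) _ _ (Hy s)).
    rewrite (is_derive_unique (fun x : R => phi x) _ _ (Hphi s)); ring. }
assert (HB : forall s, is_derive (fun s => u s * sin (phi s) + y s * cos (phi s)) s 0).
{ intros s; auto_derive.
  - split; [now exists (b s * y s)|split; [now exists (b s)|]].
    split; [now exists (- (b s * u s))|split; [now exists (b s)|trivial]].
  - rewrite (is_derive_unique (fun x : R => u x) _ _ (Hu s)).
    rewrite (is_derive_unique (fun x : R => y x) _ _ (Hy s)).
    rewrite (is_derive_unique (fun x : R => phi x) _ _ (Hphi s)); ring. }
assert (eA := is_derive_0_const _ HA t 0); assert (eB := is_derive_0_const _ HB t 0).
simpl in eA, eB; rewrite Hu0, Hy0 in eA, eB.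
assert (c0 := sin2_cos2 (phi 0)); assert (ct := sin2_cos2 (phi t)).
unfold Rsqr in c0, ct.
assert (eA' : u t * cos (phi t) - y t * sin (phi t) = r).
{ rewrite eA; rewrite <- (Rmult_1_r r) at 3; rewrite <- c0; ring. }
assert (eB' : u t * sin (phi t) + y t * cos (phi t) = 0) by (rewrite eB; ring).
split.
- transitivity (u t * (sin (phi t) * sin (phi t) + cos (phi t) * cos (phi t)));
    [rewrite ct; ring|].
  rewrite <- eA'; transitivity ((u t * cos (phi t) - y t * sin (phi t)) * cos (phi t)
    + (u t * sin (phi t) + y t * cos (phi t)) * sin (phi t)); [ring|rewrite eB'; ring].
- transitivity (y t * (sin (phi t) * sin (phi t) + cos (phi t) * cos (phi t)));
    [rewrite ct; ring|].
  rewrite <- eA'; transitivity (- (u t * cos (phi t) - y t * sin (phi t)) * sin (phi t)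
    + (u t * sin (phi t) + y t * cos (phi t)) * cos (phi t)); [ring|rewrite eB'; ring].
Qed.

(** The phase time of the angle is the elapsed time up to a constant. Time 2 PI therefore amounts to
    exactly one turn, and a shorter positive time to less than one turn, which cannot close the
    orbit when [r] is positive. *)
Lemma chart_solution_minimal_period (G X dX U : R -> R) (rho r : R) (z : R -> R * R) :
  even_shear_chart G X dX rho -> chart_inverse X dX U rho -> 0 < r < rho ->
  solution (Derive G) z -> in_chart X U rho (fst (z 0)) ->
  U (fst (z 0)) ^ 2 + snd (z 0) ^ 2 = r ^ 2 ->
  minimal_period (2 * PI) z.
Proof.
intros HX HU Hr Hz H0 Hr0.
assert (Hr' : 0 <= r < rho) by lra.
assert (Hin := chart_orbit G X dX U rho r z HX HU Hr' Hz H0 Hr0).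
set (u := fun t => U (fst (z t))); set (y := fun t => snd (z t)).
set (b := fun t => / dX (u t)).
assert (Hbp : forall t, 0 < dX (u t)).
{ intros t; apply (chart_pos _ _ _ _ HX), Hin. }
assert (Hu : forall t, is_derive u t (b t * y t)).
{ intros t; rewrite Rmult_comm; apply (chart_solution_derive G X dX U rho t z);
    auto. }
assert (Hy : forall t, is_derive y t (- (b t * u t))).
{ intros t; replace (- (b t * u t)) with (- u t / dX (u t))
    by (unfold b, Rdiv; ring).
  apply (chart_solution_derive G X dX U rho t z); auto. }
assert (Hbc : forall t, continuous b t).
{ intros t; apply (continuous_comp (fun s => dX (u s)) Rinv).
  - apply (continuous_comp u dX).
    + apply (ex_derive_continuous u); eexists; apply Hu.
    + apply (chart_continuous _ _ _ _ HX), Hin.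
  - apply (ex_derive_continuous Rinv); auto_derive; specialize (Hbp t); lra. }
destruct (polar_clockwise (u 0) (y 0)) as [th0 [hu0 hy0]].
assert (Huy : sqrt (u 0 ^ 2 + y 0 ^ 2) = r).
{ unfold u, y; rewrite Hr0; apply sqrt_pow2; lra. }
rewrite Huy in hu0, hy0.
(* The angle is the integral of the angular speed [b] from the initial angle [th0]. *)
set (phi := fun t => th0 + RInt b 0 t).
assert (Hphi : forall t, is_derive phi t (b t)).
{ intros t; unfold phi; rewrite <- (Rplus_0_l (b t)).
  apply (is_derive_plus (fun _ => th0) (fun t => RInt b 0 t)).
  - apply (is_derive_const (V := R_NormedModule)).
  - apply (is_derive_RInt b (fun t => RInt b 0 t) 0 t); [|apply Hbc].
    apply filter_forall; intros c; apply (RInt_correct (V := R_CompleteNormedModule)).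
    apply ex_RInt_continuous; intros; apply Hbc. }
assert (Hphi0 : phi 0 = th0).
{ unfold phi; rewrite RInt_point; unfold zero; simpl; ring. }
rewrite <- Hphi0 in hu0, hy0.
assert (Hrot := rotating_frame u y b phi r Hu Hy Hphi hu0 hy0).
clearbody phi.
destruct (phase_time_exists _ _ _ _ _ HX Hr') as [T [HT Hper]].
assert (Hinc := phase_time_increasing _ _ _ _ _ _ HX Hr' HT).
(* The factor [dX (r * cos (phi s))] from [T] cancels the speed [b s], since [u s] is
   [r * cos (phi s)]. *)
assert (HTphi : forall t, T (phi t) = t + T (phi 0)).
{ intros t.
  assert (Hd : forall s, is_derive (fun s => T (phi s) - s) s 0).
  { intros s; auto_derive.
    - split; [now eexists; apply HT|split; [now eexists; apply Hphi|trivial]].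
    - rewrite (is_derive_unique (fun x : R => T x) _ _ (HT (phi s))).
      rewrite (is_derive_unique (fun x : R => phi x) _ _ (Hphi s)).
      rewrite <- (proj1 (Hrot s)); unfold b; field; apply Rgt_not_eq, Hbp. }
  pose proof (is_derive_0_const _ Hd t 0) as h; simpl in h; lra. }
assert (HPI := PI_RGT_0).
assert (Hz_eq : forall s t, u s = u t -> y s = y t -> z s = z t).
{ intros s t h1 h2; rewrite (surjective_pairing (z s)), (surjective_pairing (z t)).
  f_equal; [|exact h2].
  rewrite <- (proj2 (Hin s)), <- (proj2 (Hin t)); f_equal; exact h1. }
split; [split; [lra|]|].
- intros t.
  (* Both angles have the same phase time, and [T] is strictly increasing. *)
  assert (Hstep : phi (t + 2 * PI) = phi t + 2 * PI).
  { assert (e : T (phi (t + 2 * PI)) = T (phi t + 2 * PI))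
      by (rewrite Hper, (HTphi t), HTphi; ring).
    destruct (Rtotal_order (phi (t + 2 * PI)) (phi t + 2 * PI)) as [h|[h|h]];
      [apply Hinc in h; lra|assumption|apply Hinc in h; lra]. }
  destruct (Hrot t) as [h1 h2]; destruct (Hrot (t + 2 * PI)) as [h3 h4].
  rewrite Hstep, cos_plus, cos_2PI, sin_2PI in h3.
  rewrite Hstep, sin_plus, cos_2PI, sin_2PI in h4.
  apply Hz_eq; [rewrite h1, h3|rewrite h2, h4]; ring.
- intros S [HS Hzs]; apply Rnot_lt_le; intros HS2.
  assert (HzS : z S = z 0) by (rewrite <- (Hzs 0); f_equal; ring).
  destruct (Hrot S) as [h1 h2].
  replace (u S) with (u 0) in h1 by (unfold u; now rewrite HzS).
  replace (y S) with (y 0) in h2 by (unfold y; now rewrite HzS).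
  rewrite hu0 in h1; rewrite hy0 in h2.
  assert (ec : cos (phi S) = cos (phi 0))
    by (apply (Rmult_eq_reg_l r); lra).
  assert (es : sin (phi S) = sin (phi 0))
    by (apply (Rmult_eq_reg_l r); lra).
  (* The angle has advanced by strictly between 0 and 2 PI, as [T] shows, while its sine and cosine
     are back at their initial values. *)
  apply (cos_eq_1_lt_2PI (phi S - phi 0)).
  + assert (e := HTphi S); assert (e2 := Hper (phi 0)).
    split; apply Rnot_le_lt; intros h.
    * assert (T (phi S) <= T (phi 0)); [|lra].
      destruct (Req_dec (phi S) (phi 0)) as [->|]; [lra|left; apply Hinc; lra].
    * assert (T (phi 0 + 2 * PI) <= T (phi S)); [|lra].
      destruct (Req_dec (phi S) (phi 0 + 2 * PI)) as [->|]; [lra|left; apply Hinc; lra].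
  + rewrite cos_minus, ec, es; assert (h := sin2_cos2 (phi 0)); unfold Rsqr in h; lra.
Qed.

(** * Isochrony from the existence of a chart *)

Theorem even_shear_isochronous (G X dX : R -> R) (rho : R) :
  0 < rho -> even_shear_chart G X dX rho -> isochronous_potential G.
Proof.
intros Hrho HX.
destruct (chart_inverse_exists _ _ _ _ HX) as [U HU].
assert (H0 : -rho < 0 < rho) by lra.
assert (HX0 := chart_0 _ _ _ _ HX).
destruct (HU 0 H0) as [HU0 [HdU HlocU]]; rewrite HX0 in HU0, HdU, HlocU.
(* With both |u| and |y| below rho / 2, the radius stays below [rho]. *)
assert (Hsmall : locally 0 (fun x => - (rho / 2) < U x < rho / 2 /\ in_chart X U rho x)).
{ apply filter_and; [|assumption].
  assert (Hc : continuous U 0) by (apply (ex_derive_continuous U); now eexists; apply HdU).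
  apply (Hc (fun v => - (rho / 2) < v < rho / 2)); rewrite HU0.
  apply (locally_between _ (- (rho / 2)) (rho / 2)); [lra|trivial]. }
assert (Hnear : locally ((0, 0) : R * R) (fun p => p <> (0, 0) ->
  in_chart X U rho (fst p) /\ exists r, 0 < r < rho /\ U (fst p) ^ 2 + snd p ^ 2 = r ^ 2)).
{ destruct Hsmall as [e He].
  assert (Hd : 0 < Rmin e (rho / 2)) by (apply Rmin_pos; [apply cond_pos|lra]).
  exists (mkposreal _ Hd); intros [x y] [Hx Hy] Hp.
  pose proof (Rmin_l e (rho / 2)); pose proof (Rmin_r e (rho / 2)).
  assert (Hxe : ball 0 e x) by (apply ball_le with (2 := Hx); simpl; lra).
  destruct (He x Hxe) as [h1 h2].
  apply Rabs_lt_between in Hy; unfold minus, plus, opp in Hy; simpl in Hy |- *.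
  split; [assumption|]; exists (sqrt (U x ^ 2 + y ^ 2)).
  (* The radius vanishes only at the origin, because [U x = 0] forces x = X(0) = 0. *)
  assert (Hpos : 0 < U x ^ 2 + y ^ 2).
  { destruct (Req_dec y 0) as [Hy0|Hy0]; [|nra].
    destruct (Req_dec (U x) 0) as [Hx0|Hx0]; [|nra].
    elim Hp; rewrite Hy0, <- (proj2 h2), Hx0, HX0; reflexivity. }
  split; [split|].
  - now apply sqrt_lt_R0.
  - rewrite <- (sqrt_pow2 rho) by lra; apply sqrt_lt_1_alt; split; [lra|nra].
  - fold (U x ^ 2) (y ^ 2) (sqrt (U x ^ 2 + y ^ 2) ^ 2); rewrite pow2_sqrt; lra. }
split; [|split; [split|]].
- revert HlocU; apply filter_imp; intros x [h1 <-].
  eexists; apply (chart_is_derive_potential _ _ _ _ _ HX h1).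
- assert (HG := chart_is_derive_potential _ _ _ _ _ HX H0); rewrite HX0 in HG.
  rewrite (is_derive_unique _ _ _ HG); unfold Rdiv; ring.
- revert Hnear; apply filter_imp; intros [x y] Hp Hne.
  destruct (Hp Hne) as [Hin [r [Hr Hr2]]]; simpl in Hin.
  assert (Hr' : 0 <= r < rho) by lra.
  destruct (polar_clockwise (U x) y) as [th [hu hy]].
  assert (Hsq : sqrt (U x ^ 2 + y ^ 2) = r).
  { transitivity (sqrt (r ^ 2)); [f_equal; exact Hr2|apply sqrt_pow2; lra]. }
  rewrite Hsq in hu, hy.
  destruct (chart_solution_exists _ _ _ _ _ th HX Hr') as [z [Hz Hz0]].
  rewrite <- hu, <- hy, (proj2 Hin) in Hz0.
  exists z; split; [assumption|split; [assumption|]].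
  exists (2 * PI).
  apply (chart_solution_minimal_period G X dX U rho r z HX HU Hr Hz);
    rewrite Hz0; assumption.
- revert Hnear; apply filter_imp; intros p Hp Hne z S Hz Hz0 [HSp HSmin].
  destruct (Hp Hne) as [Hin [r [Hr Hr2]]].
  assert (Hmin : minimal_period (2 * PI) z).
  { apply (chart_solution_minimal_period G X dX U rho r z HX HU Hr Hz);
      rewrite Hz0; assumption. }
  destruct Hmin as [Hper Hmin]; apply Rle_antisym; auto.
Qed.

(** * The explicit shear and the potential along it *)

(** The square of [c * u] is at most k u^2, hence strictly below the square of the root. *)
Lemma shear_root_bound (c k u : R) :
  c ^ 2 <= k -> 0 < sqrt (1 + k * u ^ 2) + c * u.
Proof.
intros Hc.
assert (Hk : 0 <= k * u ^ 2) by (assert (0 <= c ^ 2) by nra; nra).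
assert (Hle : (c * u) ^ 2 <= k * u ^ 2) by nra.
assert (Hq2 : sqrt (1 + k * u ^ 2) * sqrt (1 + k * u ^ 2) = 1 + k * u ^ 2)
  by (apply sqrt_sqrt; lra).
assert (Hq := sqrt_pos (1 + k * u ^ 2)); nra.
Qed.

(* The solution x of k (x - u)^2 + 2 c (x - u) = c^2 u^2 that vanishes at u = 0. *)
Definition shear (c k u : R) : R := u + c * u ^ 2 / (1 + sqrt (1 + k * u ^ 2)).

Lemma is_derive_shear (c k u : R) : 0 <= k ->
  is_derive (shear c k) u (1 + c * u / sqrt (1 + k * u ^ 2)).
Proof.
intros Hk; unfold shear.
assert (Hku : 0 < 1 + k * u ^ 2) by nra.
assert (Hq := sqrt_lt_R0 _ Hku).
assert (Hq2 := sqrt_sqrt _ (Rlt_le _ _ Hku)).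
auto_derive; replace (u * (u * 1)) with (u ^ 2) by ring.
- repeat split; [assumption|lra].
- set (q := sqrt (1 + k * u ^ 2)) in *.
  assert (Hkq : k * u ^ 2 = q * q - 1) by lra.
  assert (Hnum : c * u * (k * u ^ 2) = c * u * (q * q - 1)) by now rewrite Hkq.
  field_simplify_eq; [lra|split; lra].
Qed.

(** The two forms are linked by k u^2 = (q - 1)(q + 1). The second is kept free of division because
    [k] may be 0. *)
Lemma shear_offset (c k u : R) : 0 <= k ->
  let q := sqrt (1 + k * u ^ 2) in
  (shear c k u - u) * (1 + q) = c * u ^ 2 /\ k * (shear c k u - u) = c * (q - 1).
Proof.
intros Hk q.
assert (Hq2 : q * q = 1 + k * u ^ 2) by (apply sqrt_sqrt; nra).
assert (Hq : 0 <= q) by apply sqrt_pos.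
assert (H : (shear c k u - u) * (1 + q) = c * u ^ 2)
  by (unfold shear; fold q; field; lra).
split; [assumption|].
apply Rmult_eq_reg_r with (1 + q); [|lra].
rewrite Rmult_assoc, H; replace (k * (c * u ^ 2)) with (c * (k * u ^ 2)) by ring.
replace (k * u ^ 2) with (q * q - 1) by lra; ring.
Qed.

(** The shear is chosen to turn the radicand of the potential into a perfect square, so that the
    root disappears. *)
Lemma shear_radicand (c k u : R) : 0 <= k ->
  1 + k * shear c k u ^ 2 + 2 * c * shear c k u = (sqrt (1 + k * u ^ 2) + c * u) ^ 2.
Proof.
intros Hk; destruct (shear_offset c k u Hk) as [H1 H2].
assert (Hq2 : sqrt (1 + k * u ^ 2) * sqrt (1 + k * u ^ 2) = 1 + k * u ^ 2)
  by (apply sqrt_sqrt; nra).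
set (q := sqrt (1 + k * u ^ 2)) in *; set (x := shear c k u) in *.
assert (H3 : k * (x - u) * (x + u) = c * (q - 1) * (x + u)) by now rewrite H2.
assert (H4 : c * ((x - u) * (1 + q)) = c * (c * u ^ 2)) by now rewrite H1.
lra.
Qed.

Lemma potential_sqrt_shear (alpha beta gamma u : R) : 2 * alpha ^ 2 <= beta ->
  let k := beta * gamma ^ 2 / 2 in
  let x := shear (alpha * gamma) k u in
  sqrt (2 * (2 + beta * gamma ^ 2 * x ^ 2 + 4 * alpha * gamma * x))
  = 2 * (sqrt (1 + k * u ^ 2) + alpha * gamma * u).
Proof.
intros Hb k x.
assert (Hck : (alpha * gamma) ^ 2 <= k).
{ unfold k; assert (0 <= gamma ^ 2) by nra; nra. }
assert (Hp := shear_root_bound _ _ u Hck).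
assert (Hk : 0 <= k) by (assert (0 <= (alpha * gamma) ^ 2) by nra; lra).
assert (Hr := shear_radicand (alpha * gamma) k u Hk); fold x in Hr.
rewrite <- (sqrt_pow2 (2 * (sqrt (1 + k * u ^ 2) + alpha * gamma * u))) by lra.
f_equal; rewrite Rpow_mult_distr, <- Hr; unfold k; field.
Qed.

(** Once the root is resolved, the numerator inside the square becomes linear in [u], with a
    coefficient that cancels the denominator up to the factor 2. *)
Lemma potential_formula_shear (alpha beta gamma u : R) :
  gamma <> 0 -> 2 * alpha ^ 2 < beta ->
  potential_formula alpha beta gamma
    (shear (alpha * gamma) (beta * gamma ^ 2 / 2) u) = u ^ 2 / 2.
Proof.
intros Hg Hb; unfold potential_formula.
rewrite potential_sqrt_shear by lra.
assert (Hk : 0 <= beta * gamma ^ 2 / 2) by (assert (0 <= gamma ^ 2) by nra; nra).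
destruct (shear_offset (alpha * gamma) _ u Hk) as [_ H].
set (q := sqrt _) in *; set (x := shear _ _ _) in *.
assert (HN : 2 * alpha + beta * gamma * x - alpha * (2 * (q + alpha * gamma * u))
  = gamma * (beta - 2 * alpha ^ 2) * u).
(* The extra factor [gamma] turns the coefficients into c and k, so that [shear_offset] applies
   linearly. *)
{ apply Rmult_eq_reg_l with gamma; [lra|assumption]. }
rewrite HN; field; split; [lra|assumption].
Qed.

(** * Removing the singularity at the boundary value of [beta] *)

(** Multiplying the numerator by [s + 2 + 2 * alpha * gamma * x] exposes the factor
    [beta - 2 * alpha ^ 2], which cancels; the resulting form also makes sense on the boundary. *)
Lemma potential_formula_rationalized (alpha beta gamma x : R) :
  let s := sqrt (2 * (2 + beta * gamma ^ 2 * x ^ 2 + 4 * alpha * gamma * x)) in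
  gamma <> 0 -> beta <> 2 * alpha ^ 2 ->
  0 <= 2 * (2 + beta * gamma ^ 2 * x ^ 2 + 4 * alpha * gamma * x) ->
  s + 2 + 2 * alpha * gamma * x <> 0 ->
  potential_formula alpha beta gamma x
  = (x - 2 * alpha * gamma * x ^ 2 / (s + 2 + 2 * alpha * gamma * x)) ^ 2 / 2.
Proof.
intros s Hg Hb Hr HD; unfold potential_formula; fold s.
assert (Hs := sqrt_sqrt _ Hr); fold s in Hs.
set (D := s + 2 + 2 * alpha * gamma * x) in *.
assert (HN : 2 * alpha + beta * gamma * x - alpha * s
  = gamma * (beta - 2 * alpha ^ 2) * (x - 2 * alpha * gamma * x ^ 2 / D)).
{ apply Rmult_eq_reg_r with D; [|assumption].
  replace (gamma * (beta - 2 * alpha ^ 2) * (x - 2 * alpha * gamma * x ^ 2 / D) * D)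
    with (gamma * (beta - 2 * alpha ^ 2) * (x * D - 2 * alpha * gamma * x ^ 2))
    by (field; assumption).
  assert (Hs' : alpha * (s * s) = alpha *
    (2 * (2 + beta * gamma ^ 2 * x ^ 2 + 4 * alpha * gamma * x))) by now rewrite Hs.
  unfold D; lra. }
rewrite HN; field; repeat split; try assumption; lra.
Qed.

(** At the boundary the radicand is the square of [2 * (1 + alpha * gamma * x)], and positivity of
    this number selects the root. The rationalized form is continuous there, so the limit is its
    value. *)
Lemma potential_formula_limit (alpha gamma x : R) :
  gamma <> 0 -> 0 < 1 + alpha * gamma * x ->
  Lim (fun b => potential_formula alpha b gamma x) (2 * alpha ^ 2)
  = (x - alpha * gamma * x ^ 2 / (2 * (1 + alpha * gamma * x))) ^ 2 / 2.
Proof.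
intros Hg Hx.
set (rad := fun b => 2 * (2 + b * gamma ^ 2 * x ^ 2 + 4 * alpha * gamma * x)).
assert (Hrad0 : rad (2 * alpha ^ 2) = (2 * (1 + alpha * gamma * x)) ^ 2)
  by (unfold rad; ring).
assert (Hradpos : 0 < rad (2 * alpha ^ 2)) by (rewrite Hrad0; apply pow_lt; lra).
set (f := fun b =>
  (x - 2 * alpha * gamma * x ^ 2 / (sqrt (rad b) + 2 + 2 * alpha * gamma * x)) ^ 2 / 2).
assert (Hlim : is_lim f (2 * alpha ^ 2) (f (2 * alpha ^ 2))).
{ apply is_lim_continuity, continuity_pt_filterlim, (ex_derive_continuous f).
  assert (Hs := sqrt_pos (rad (2 * alpha ^ 2))).
  unfold f, rad in *; auto_derive; repeat split; simpl in *; lra. }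
replace (Finite ((x - _) ^ 2 / 2)) with (Finite (f (2 * alpha ^ 2))).
2:{ f_equal; unfold f; rewrite Hrad0, sqrt_pow2 by lra; field; lra. }
apply is_lim_unique, is_lim_ext_loc with (2 := Hlim).
assert (Hnear : locally (2 * alpha ^ 2) (fun b => 0 < rad b)).
{ assert (Hc : continuous rad (2 * alpha ^ 2)).
  { apply (ex_derive_continuous rad); unfold rad; auto_derive; trivial. }
  apply (Hc (fun v => 0 < v)); now apply open_gt. }
destruct Hnear as [e He]; exists e; intros b Hb Hne.
assert (Hr := He b Hb); unfold f; symmetry.
apply potential_formula_rationalized; try assumption; unfold rad in *; try lra.
assert (Hs := sqrt_pos (rad b)); unfold rad in Hs; lra.
Qed.

Lemma potential_shear (alpha beta gamma u : R) :
  gamma <> 0 -> 2 * alpha ^ 2 <= beta ->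
  potential alpha beta gamma
    (shear (alpha * gamma) (beta * gamma ^ 2 / 2) u) = u ^ 2 / 2.
Proof.
intros Hg Hb; unfold potential; destruct (Req_EM_T _ _) as [e|e].
2:{ apply potential_formula_shear; [assumption|lra]. }
set (c := alpha * gamma).
replace (beta * gamma ^ 2 / 2) with (c ^ 2) by (rewrite e; unfold c; field).
assert (Hk : 0 <= c ^ 2) by nra.
assert (Hp := shear_root_bound c _ u (Rle_refl _)).
destruct (shear_offset c _ u Hk) as [H1 H2].
assert (Hq2 : sqrt (1 + c ^ 2 * u ^ 2) * sqrt (1 + c ^ 2 * u ^ 2) = 1 + c ^ 2 * u ^ 2)
  by (apply sqrt_sqrt; nra).
assert (Hq0 := sqrt_pos (1 + c ^ 2 * u ^ 2)).
set (q := sqrt (1 + c ^ 2 * u ^ 2)) in *; set (x := shear c (c ^ 2) u) in *.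
(* [shear_offset] gives this identity multiplied by [c]; for [c = 0] both sides vanish, as then
   [q = 1]. *)
assert (Hcw : c * (x - u) = q - 1).
{ destruct (Req_dec c 0) as [Hc|Hc].
  - rewrite Hc in *; nra.
  - apply Rmult_eq_reg_l with c; [lra|assumption]. }
(* The side condition holds because [Hcw] reads 1 + c x = q + c u, which is positive by [Hp]. *)
rewrite potential_formula_limit; [simpl|assumption|fold c; lra].
fold c.
replace (c * (x * (x * 1)) / (2 * (1 + c * x))) with (x - u); [field|].
assert (Hw : (x - u) * (c * (x - u)) = (x - u) * (q - 1)) by now rewrite Hcw.
apply Rmult_eq_reg_r with (2 * (1 + c * x)); [|lra].
field_simplify; lra.
Qed.

Theorem mainTheorem4 (alpha beta gamma : R)
  (hgamma : gamma <> 0) (hbeta : 2 * alpha ^ 2 <= beta) :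
  isochronous_potential (potential alpha beta gamma).
Proof.
set (c := alpha * gamma); set (k := beta * gamma ^ 2 / 2).
assert (Hck : c ^ 2 <= k).
{ unfold c, k; assert (0 <= gamma ^ 2) by nra; nra. }
assert (Hk : 0 <= k) by (assert (0 <= c ^ 2) by nra; lra).
assert (Hq : forall u, 0 < sqrt (1 + k * u ^ 2)).
{ intros u; apply sqrt_lt_R0; nra. }
(* The radius 1 is an arbitrary choice: the chart conditions are verified for every real [u]. *)
apply (even_shear_isochronous _ (shear c k)
  (fun u => 1 + c * u / sqrt (1 + k * u ^ 2)) 1); [lra|split].
- unfold shear; field; assert (h := sqrt_pos (1 + k * 0 ^ 2)); lra.
- intros u _; now apply is_derive_shear.
- intros u _; apply (ex_derive_continuous (fun u => 1 + c * u / sqrt (1 + k * u ^ 2))).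
  assert (h := Hq u); simpl in h; auto_derive; repeat split; [simpl; nra|lra].
- intros u _; assert (h := Hq u).
  replace (1 + c * u / sqrt (1 + k * u ^ 2))
    with ((sqrt (1 + k * u ^ 2) + c * u) / sqrt (1 + k * u ^ 2)) by (field; lra).
  apply Rdiv_lt_0_compat; [now apply shear_root_bound|assumption].
- intros u _; assert (h := Hq u).
  replace ((- u) ^ 2) with (u ^ 2) by ring; field; lra.
- intros u _; now apply potential_shear.
Qed.
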